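(* Let $d \geq 1$ be an integer and let $\mu$ be a probability measure on $\mathbb{Z}^d$. The set of functions $f : \mathbb{Z}^d \to \mathbb{R}_+$ that are harmonic relative to $\mu$ is stable under taking point-wise limits (of sequences) if and only if the set $E_\mu^1 = \{ s \in \mathbb{R}^d : \int_{\mathbb{Z}^d} e^{x\cdot s}\, d\mu(x) = 1 \}$ is a closed subset of $\mathbb{R}^d$.
   Context: Here $\mathbb{R}_+ = [0,+\infty)$, and $x \cdot s$ is the usual dot product on $\mathbb{R}^d$. Given a probability measure $\mu$ on $\mathbb{Z}^d$, a function $f : \mathbb{Z}^d \to \mathbb{R}_+$ is called harmonic relative to $\mu$ if $f(x_0) = \int_{\mathbb{Z}^d} f(x_0 + x)\, d\mu(x)$ for every $x_0 \in \mathbb{Z}^d$. The integrals of non-negative functions take values in $[0,+\infty]$. Stability under point-wise limits means: whenever $(f_n)$ is a sequence of non-negative functions harmonic relative to $\mu$ and $f : \mathbb{Z}^d \to \mathbb{R}_+$ satisfies $f_n(x) \to f(x)$ for every $x \in \mathbb{Z}^d$, then $f$ is harmonic relative to $\mu$. *)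

(* Defs.v *)
From HB Require Import structures.
From mathcomp Require Import all_boot all_order all_algebra.
From mathcomp Require Import all_classical all_reals all_analysis.
Set Implicit Arguments.
Unset Strict Implicit.
Unset Printing Implicit Defensive.
Import Order.TTheory GRing.Theory Num.Theory.
Import numFieldNormedType.Exports.
Local Open Scope classical_set_scope.
Local Open Scope ring_scope.

Definition Zlattice (d : nat) : Type := 'rV[int]_d.

HB.instance Definition _ (d : nat) := GRing.Zmodule.on (Zlattice d).
HB.instance Definition _ (d : nat) := Countable.on (Zlattice d).
HB.instance Definition _ (d : nat) := isPointed.Build (Zlattice d) 0.

HB.instance Definition _ (d : nat) := @isMeasurable.Build default_measure_display
  (Zlattice d) (@discrete_measurable (Zlattice d))
  (@discrete_measurable0 (Zlattice d)) (@discrete_measurableC (Zlattice d))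
  (@discrete_measurableU (Zlattice d)).

Section Harmonic.
Variables (R : realType) (d : nat).
Implicit Types (mu : probability (Zlattice d) R) (f : Zlattice d -> R).

Definition harmonic mu f : Prop :=
  forall x0 : Zlattice d, (f x0)%:E = (\int[mu]_x (f (x0 + x))%:E)%E.

Definition nonneg_harmonic mu : set (Zlattice d -> R) :=
  [set f | (forall x, 0 <= f x) /\ harmonic mu f].

(* Only sequences whose limit is finite at every point are concerned. *)
Definition stable_pointwise_limits mu : Prop :=
  forall (fs : nat -> Zlattice d -> R) (f : Zlattice d -> R),
    (forall n, nonneg_harmonic mu (fs n)) ->
    (forall x, 0 <= f x) ->
    (forall x, fs n x @[n --> \oo] --> f x) ->
    nonneg_harmonic mu f.

Definition dotp (x : Zlattice d) (s : 'rV[R]_d) : R :=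
  \sum_(i < d) (x ord0 i)%:~R * s ord0 i.

Definition E1 mu : set 'rV[R]_d :=
  [set s | (\int[mu]_x (expR (dotp x s))%:E = 1)%E].

End Harmonic.

(* Main.v *)
Require Import Defs.
From mathcomp Require Import all_boot all_order all_algebra.
From mathcomp Require Import all_classical all_reals all_analysis.
From mathcomp Require Import ring lra.
Import numFieldNormedType.Exports.

(** Enumerate the lattice and write [mu] as weights [p k] at points [e k].
    For [f >= 0] the truncated defects [f x - \sum_(k < n) p k * f (x + e k)]
    decrease with [n], and [f] is harmonic exactly when they tend to [0].

    If nonnegative harmonic functions are stable under limits, then [E1 mu] is
    closed because [s \in E1 mu] means that [x |-> expR (dotp x s)] is harmonic,
    and this function depends continuously on [s].

    Conversely let [E1 mu] be closed.  By Fatou a limit of harmonic functions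
    has nonnegative defects; what has to be excluded is a loss of mass at
    infinity, and for this it suffices to bound the [n]-th defect by a small
    quantity, with an [n] that works for all harmonic functions at once.
    For the exponentials with exponent in [E1 mu] such a bound is Dini's theorem
    ([uniform_laplace]): pick a basis [B j] of the rational span of the support
    of [mu].  Then [1 - \sum_(k < n) p k * expR (dotp (e k) s)] is at most [eps]
    times [1 + \sum_j (expR (dotp (B j) s) + expR (- dotp (B j) s))], trivially
    where the latter sum is large, and on the remaining part of [E1 mu], which is
    compact modulo directions orthogonal to the support, because continuous
    functions decreasing to [0] on a compact set do so uniformly.

    The bound then holds with every nonnegative harmonic [h] in place of the
    exponential ([defect_le_two_sided]).  One could deduce this from the theorem
    of Choquet and Deny that [h] is a mixture of exponentials; the argument below
    needs only the extremality idea behind that theorem.  Were the bound false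
    for [h], a continuous linear functional [F] would be negative at [h].
    Minimise [F] over the cone of functions whose iterated defects are all
    nonnegative, cut down to a set that is compact for pointwise convergence by
    the condition [\sum_i w i * f (e i) <= 1].  Among the minimisers take one
    that is best for a strictly concave criterion; it is extremal
    ([extremal_minimiser]).  Since [f] splits inside the cone as the sum of
    [x |-> p k * f (x + e k)] and the rest, extremality makes every translate
    [x |-> f (x + e k)] with [0 < p k] a multiple of [f], so that [f] is an
    exponential along the group generated by the support
    ([multiplicative_exp]).  The cone contains functions that are not harmonic;
    a penalty, namely a sum of defects that converges at [h], is added to [F] so
    that the minimiser is harmonic ([extremal_harmonic]).  Its exponent is
    therefore in [E1 mu], where the bound is known. *)

Set Implicit Arguments.
Unset Strict Implicit.
Unset Printing Implicit Defensive.
Import Order.TTheory GRing.Theory Num.Theory.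
Local Open Scope classical_set_scope.
Local Open Scope ring_scope.

(** * Limits and continuity of finite sums *)

Lemma cvg_sumr (R : realType) (T : Type) (F : set_system T) (I : Type)
    (r : seq I) (f : I -> T -> R) (a : I -> R) : Filter F ->
  (forall i, f i x @[x --> F] --> a i) ->
  \sum_(i <- r) f i x @[x --> F] --> \sum_(i <- r) a i.
Proof.
move=> FF fa; apply: (@cvg_big R^o I +%R 0 xpredT) => [|i _]; last exact: fa.
exact: (@add_continuous R^o).
Qed.

Lemma continuous_addr (R : realType) (T : topologicalType) (u v : T -> R) :
  continuous u -> continuous v -> continuous (fun t => u t + v t).
Proof. by move=> cu cv t; apply: cvgD; [exact: cu|exact: cv]. Qed.

Lemma continuous_mx_entry (R : realType) (T : topologicalType) m n
    (f : T -> 'M[R]_(m, n)) :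
  (forall i j, continuous (fun t => f t i j)) -> continuous f.
Proof.
move=> cf t; apply/cvg_ballP => eps eps0.
have : \forall u \near t, forall i j, ball (f t i j) eps (f u i j).
  apply: filter_forall => i; apply: filter_forall => j.
  by have /cvg_ballP := cf i j t; apply.
by apply: filterS => u; exact.
Qed.

Lemma continuous_sumr_scale (R : realType) (T : topologicalType) (I : Type)
    (r : seq I) (a : I -> R) (f : I -> T -> R) :
  (forall i, continuous (f i)) ->
  continuous (fun t => \sum_(i <- r) a i * f i t).
Proof. by move=> cf t; apply: cvg_sumr => i; apply: cvgMl_tmp; exact: cf. Qed.

Lemma nneseries_EFin (R : realType) (a : nat -> R) (l : R) :
  (forall k, 0 <= a k) ->
  (\sum_(0 <= k <oo) (a k)%:E = l%:E)%E <->
  (\sum_(k < n) a k @[n --> \oo] --> l).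
Proof.
move=> a0.
have E : (fun n => \sum_(0 <= k < n) (a k)%:E)%E =
    (fun n => (\sum_(k < n) a k)%:E).
  by apply/funext => n; rewrite sumEFin big_mkord.
have cv : cvgn (fun n => \sum_(0 <= k < n) (a k)%:E)%E.
  by apply: is_cvg_ereal_nneg_natsum => k _; rewrite lee_fin.
split=> [al|al].
  by move: cv; rewrite [X in _ --> X]al E => /fine_cvg.
apply: cvg_lim => //; rewrite E; apply: cvg_EFin => //.
exact: nearW.
Qed.

(** * Minimising suprema of monotone sequences on compact sets *)

Lemma closed_fun_le (R : realType) (T : topologicalType) (g : T -> R) (b : R) :
  continuous g -> closed [set x | g x <= b].
Proof.
by move=> cg; apply: (@preimage_closed _ _ g [set y | y <= b]) => //;
  exact: closed_le.
Qed.

Lemma closed_fun_ge (R : realType) (T : topologicalType) (g : T -> R) (b : R) :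
  continuous g -> closed [set x | b <= g x].
Proof.
by move=> cg; apply: (@preimage_closed _ _ g [set y | b <= y]) => //;
  exact: closed_ge.
Qed.

(** Directedness is only asked inside [K], where the sublevel sets of a sequence
    of functions that is monotone on [K] are nested. *)
Lemma compact_directed_inter (T : topologicalType) (I : Type) (K : set T)
    (D : set I) (C : I -> set T) :
  compact K -> D !=set0 -> (forall i, D i -> closed (C i)) ->
  (forall i j, D i -> D j ->
    exists2 k, D k & K `&` C k `<=` C i `&` C j) ->
  (forall i, D i -> K `&` C i !=set0) ->
  exists2 x, K x & forall i, D i -> C i x.
Proof.
move=> cK [i0 Di0] clC dirC neC.
pose F := filter_from D (fun i => K `&` C i).
have FF : ProperFilter F.
  apply: filter_from_proper => //; apply: filter_from_filter; first by exists i0.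
  move=> i j Di Dj; have [k Dk kij] := dirC _ _ Di Dj; exists k => // x KCx.
  by have [? ?] := kij _ KCx; have [? ?] := KCx.
have FK : F K by exists i0 => // x [].
have [x [Kx clx]] := cK F FF FK.
exists x => // i Di; apply: (clC i Di) => B xB.
have [|y [[Ky Cy] By]] := clx (K `&` C i) B _ xB; first by exists i.
by exists y.
Qed.

Section Minimisation.
Variables (R : realType) (T : topologicalType).
Implicit Types (K : set T) (g : nat -> T -> R).

(** [m] is a lower bound on [K] of the pointwise supremum of the [g n].  Speaking
    of upper bounds instead of that supremum keeps infinite values away. *)
Definition sup_minimum K g (m : R) :=
  forall x b, K x -> (forall n, g n x <= b) -> m <= b.

(** A supremum of continuous functions is lower semicontinuous, hence attains
    its minimum on a compact set as soon as it is finite somewhere. *)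
Lemma sup_minimum_exists K g x0 b0 :
  compact K -> (forall n, continuous (g n)) ->
  (forall x, K x -> {homo (g^~ x) : n k / (n <= k)%N >-> n <= k}) ->
  K x0 -> (forall n, g n x0 <= b0) ->
  exists2 m, sup_minimum K g m & exists2 x, K x & forall n, g n x <= m.
Proof.
move=> cK cg mg Kx0 gb0.
pose D := [set nb : nat * R | exists2 q, K q & forall n, g n q <= nb.2].
pose C (nb : nat * R) := [set x | g nb.1 x <= nb.2].
have [||||x Kx Cx] := @compact_directed_inter T _ K D C cK.
- by exists (0%N, b0), x0.
- by move=> nb _; exact: closed_fun_le.
- move=> [n b] [k c] Db Dc; exists (maxn n k, Num.min b c).
    by move: Db Dc; case: leP => _ [q Kq qb] [r Kr rc]; [exists q|exists r].
  move=> x [Kx]; rewrite /C /= le_min => /andP[xb xc].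
  by split=> /=; [apply: le_trans xb|apply: le_trans xc]; apply: mg;
    rewrite ?leq_maxl ?leq_maxr.
- by move=> [n b] [q Kq qb]; exists q; split=> //; exact: qb.
have gxb n b q : K q -> (forall k, g k q <= b) -> g n x <= b.
  by move=> Kq qb; apply: (Cx (n, b)); exists q.
have hs : has_sup (range (g^~ x)).
  by split; [exists (g 0%N x), 0%N|exists b0 => _ [n _ <-]; exact: gxb gb0].
exists (sup (range (g^~ x))).
  move=> q b Kq qb; apply: ge_sup; first by case: hs.
  by move=> _ [n _ <-]; exact: gxb qb.
by exists x => // n; apply: sup_upper_bound => //; exists n.
Qed.

(** If the values at [x] and [y] average to at most the minimum, then both
    are minimal and nothing can be gained: this is how extremality of a minimiser
    is obtained, with [eta] measuring the strictness of concavity. *)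
Lemma sup_minimum_midpoint K g m x y eta N0 :
  sup_minimum K g m ->
  (forall x, K x -> {homo (g^~ x) : n k / (n <= k)%N >-> n <= k}) ->
  K x -> K y -> 0 <= eta ->
  (forall n, (N0 <= n)%N -> g n x + g n y <= 2 * m - 2 * eta) ->
  eta = 0 /\ forall n, g n x <= m.
Proof.
move=> minm mg Kx Ky eta0 gxy.
have near_m z t : K z -> t < m -> exists n, t < g n z.
  move=> Kz; apply: contraPP => /forallNP gt.
  by apply/negP; rewrite -leNgt; apply: (minm z) => // n; rewrite leNgt; apply/negP.
have large a b n k : a < g n x -> b < g k y -> a + b < 2 * m - 2 * eta.
  move=> an bk; pose N := maxn N0 (maxn n k).
  have /gxy : (N0 <= N)%N by rewrite leq_maxl.
  have : g n x <= g N x by apply: mg => //; rewrite /N maxnCA leq_maxl.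
  have : g k y <= g N y by apply: mg => //; rewrite /N (maxnC n) maxnCA leq_maxl.
  lra.
split.
  apply/eqP/negPn/negP => eta_neq0.
  have eta_gt0 : 0 < eta by rewrite lt_def eta_neq0.
  have [n Hn] : exists n, m - eta < g n x by apply: near_m => //; lra.
  have [k Hk] : exists n, m - eta < g n y by apply: near_m => //; lra.
  have := large _ _ _ _ Hn Hk; lra.
move=> n; rewrite leNgt; apply/negP => mn.
pose d := (g n x - m) / 2.
have [k Hk] : exists k, m - d < g k y by apply: near_m => //; rewrite /d; lra.
have Hn : m + d < g n x by rewrite /d; lra.
have := large _ _ _ _ Hn Hk; lra.
Qed.

End Minimisation.

(** * The cone of functions with nonnegative defects *)

Section Defect.
Variables (R : realType) (G : zmodType) (e : nat -> G) (p : nat -> R).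
Hypothesis p_ge0 : forall k, 0 <= p k.
Implicit Types f g : G -> R.

Definition defect (n : nat) f : G -> R :=
  fun x => f x - \sum_(k < n) p k * f (x + e k).

(** The nonnegative harmonic functions, in terms of defects. *)
Definition null_defect f : Prop :=
  (forall x, 0 <= f x) /\ forall x, defect n f x @[n --> \oo] --> 0.

(** The defects of a function with nonnegative defects may be negative; asking
    for all iterates gives a cone that is stable under defects.  It contains the
    nonnegative harmonic functions and, contrary to them, is always closed for
    pointwise convergence. *)
Definition pos_defects : set (G -> R) :=
  [set f | forall (ns : seq nat) x, 0 <= foldr defect f ns x].

Lemma defect_lin n a b f g :
  defect n (fun x => a * f x + b * g x) =
  (fun x => a * defect n f x + b * defect n g x).
Proof.
apply/funext => x; rewrite /defect !mulrBr !mulr_sumr addrACA -opprD -big_split.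
by congr (_ - _); apply: eq_bigr => k _ /=; ring.
Qed.

Lemma defects_lin ns a b f g :
  foldr defect (fun x => a * f x + b * g x) ns =
  (fun x => a * foldr defect f ns x + b * foldr defect g ns x).
Proof. by elim: ns => //= n ns ->; rewrite defect_lin. Qed.

Lemma defects_shift ns y f :
  foldr defect (fun x => f (x + y)) ns = (fun x => foldr defect f ns (x + y)).
Proof.
elim: ns => //= n ns ->; apply/funext => x; rewrite /defect.
by congr (_ - _); apply: eq_bigr => k _; rewrite addrAC.
Qed.

Lemma defect_shift n y f :
  defect n (fun x => f (x + y)) = (fun x => defect n f (x + y)).
Proof. exact: (defects_shift [:: n]). Qed.

Lemma defectS n f x : defect n.+1 f x = defect n f x - p n * f (x + e n).
Proof. by rewrite /defect big_ord_recr /= opprD addrA. Qed.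

Lemma defect_homo f x : (forall y, 0 <= f y) ->
  {homo (fun n => defect n f x) : n m / (n <= m)%N >-> m <= n}.
Proof.
move=> f0; apply/nonincreasing_seqP => n; rewrite defectS gerBl.
exact: mulr_ge0.
Qed.

Lemma defectC n m f : defect n (defect m f) = defect m (defect n f).
Proof.
apply/funext => x; rewrite /defect.
have E a b :
   \sum_(k < a) p k * (f (x + e k) - \sum_(j < b) p j * f (x + e k + e j)) =
   \sum_(k < a) p k * f (x + e k) -
   \sum_(k < a) \sum_(j < b) p k * p j * f (x + e k + e j).
  rewrite -sumrB; apply: eq_bigr => k _; rewrite mulrBr mulr_sumr; congr (_ - _).
  by apply: eq_bigr => j _; rewrite mulrA.
have X : \sum_(k < m) \sum_(j < n) p k * p j * f (x + e k + e j) =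
         \sum_(k < n) \sum_(j < m) p k * p j * f (x + e k + e j).
  rewrite exchange_big; apply: eq_bigr => k _; apply: eq_bigr => j _.
  by rewrite (addrAC x) (mulrC (p j)).
by rewrite !E X; ring.
Qed.

(** The defects of a harmonic function are its remaining series, with nonnegative
    terms; the defect operators commute, so the result is again harmonic. *)
Lemma null_defect_defect n f : null_defect f -> null_defect (defect n f).
Proof.
move=> [f0 fd]; split=> x.
  rewrite -(cvg_lim _ (fd x)) //.
  by apply: nonincreasing_cvgn_ge; [exact: defect_homo|apply/cvg_ex; exists 0].
rewrite (_ : (fun _ => _) = (fun m => defect m f x -
    \sum_(k < n) p k * defect m f (x + e k))); last first.
  by apply/funext => m; rewrite defectC.
have zero : 0 - \sum_(k < n) p k * 0 = 0 :> R.
  by rewrite big1 ?subr0 // => k _; rewrite mulr0.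
rewrite -[X in _ --> X]zero.
apply: cvgB; first exact: fd.
apply: cvg_sumr => k; apply: cvgMl_tmp; exact: fd.
Qed.

Lemma null_defect_shift y f :
  null_defect f -> null_defect (fun x => f (x + y)).
Proof.
move=> [f0 fd]; split=> x //.
rewrite (_ : (fun _ => _) = (fun n => defect n f (x + y))) //.
by apply/funext => n; rewrite defect_shift.
Qed.

Lemma null_defect_pos f : null_defect f -> pos_defects f.
Proof.
move=> fh ns; suff [] : null_defect (foldr defect f ns) by [].
by elim: ns => //= n ns; exact: null_defect_defect.
Qed.

Lemma pos_defects_ge0 f x : pos_defects f -> 0 <= f x.
Proof. by move=> /(_ [::] x). Qed.

Lemma pos_defects_defect_ge0 f n x : pos_defects f -> 0 <= defect n f x.
Proof. by move=> /(_ [:: n] x). Qed.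

Lemma pos_defects_lin a b f g : 0 <= a -> 0 <= b ->
  pos_defects f -> pos_defects g -> pos_defects (fun x => a * f x + b * g x).
Proof.
by move=> a0 b0 hf hg ns x; rewrite defects_lin addr_ge0 // mulr_ge0.
Qed.

Lemma pos_defects_shift y f :
  pos_defects f -> pos_defects (fun x => f (x + y)).
Proof. by move=> hf ns x; rewrite defects_shift; exact: hf. Qed.

(** Removing one term of the series leaves a defect plus finitely many translates;
    with [pos_defects_shift] this splits [f] inside the cone. *)
Lemma pos_defects_sub_shift k f :
  pos_defects f -> pos_defects (fun x => f x - p k * f (x + e k)).
Proof.
move=> hf.
have -> : (fun x => f x - p k * f (x + e k)) =
    (fun x => 1 * defect k.+1 f x + 1 * (\sum_(j < k) p j * f (x + e j))).
  by apply/funext => x; rewrite /defect big_ord_recr /=; ring.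
apply: pos_defects_lin => //.
  by move=> ns x; have := hf (rcons ns k.+1) x; rewrite foldr_rcons.
elim: k => [|k IH].
  rewrite (_ : (fun _ => _) = (fun x => 0 * f x + 0 * f x)); last first.
    by apply/funext => x; rewrite big_ord0; ring.
  exact: pos_defects_lin.
rewrite (_ : (fun _ => _) = (fun x => 1 * (\sum_(j < k) p j * f (x + e j)) +
    p k * f (x + e k))); last first.
  by apply/funext => x; rewrite big_ord_recr /=; ring.
by apply: pos_defects_lin => //; exact: pos_defects_shift.
Qed.

Lemma eval_continuous x : continuous (fun f : {ptws G -> R} => f x).
Proof. exact: (@proj_continuous G (fun _ => R) x). Qed.

(** Parametrised by [h] so that it can be proved on an abstract space; it is
    applied to the product topology with [h] the identity. *)
Lemma defects_continuous (T : topologicalType) (h : T -> G -> R) ns x :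
  (forall y, continuous (fun t => h t y)) ->
  continuous (fun t => foldr defect (h t) ns x).
Proof.
move=> ch; elim: ns x => [|n ns IH] x /=; first exact: ch.
move=> t; apply: cvgB; first exact: IH.
by apply: cvg_sumr => k; apply: cvgMl_tmp; exact: IH.
Qed.

Lemma closed_pos_defects : closed (pos_defects : set {ptws G -> R}).
Proof.
rewrite (_ : pos_defects = \bigcap_(nx in [set: seq nat * G])
    [set f : {ptws G -> R} | 0 <= foldr defect f nx.1 nx.2]).
  apply: closed_bigI => -[ns x] _; apply: closed_fun_ge.
  by apply: (@defects_continuous {ptws G -> R} id) => y; exact: eval_continuous.
by apply/seteqP; split=> f hf; [move=> [ns x] _; exact: hf|
  move=> ns x; exact: (hf (ns, x))].
Qed.

End Defect.

(** * Extremal points of a compact cap *)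

Section Extremal.
Variables (R : realType) (G : zmodType) (e : nat -> G) (p w : nat -> R).
Hypothesis p_ge0 : forall k, 0 <= p k.
Hypothesis e_surj : forall x, exists i, e i = x.
Hypothesis w_gt0 : forall i, 0 < w i.
Implicit Types f : G -> R.

Definition wsum f (n : nat) : R := \sum_(i < n) w i * f (e i).

(** A strictly concave function of [f], with nonnegative terms on [cap]. *)
Definition saturation f (n : nat) : R :=
  \sum_(i < n) 2^-1 ^+ i * (1 - (w i * f (e i)) ^+ 2).

Lemma wsum_continuous (T : topologicalType) (h : T -> G -> R) n :
  (forall y, continuous (fun t => h t y)) ->
  continuous (fun t => wsum (h t) n).
Proof. by move=> ch t; apply: cvg_sumr => i; apply: cvgMl_tmp; exact: ch. Qed.

Lemma saturation_continuous (T : topologicalType) (h : T -> G -> R) n :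
  (forall y, continuous (fun t => h t y)) ->
  continuous (fun t => saturation (h t) n).
Proof.
move=> ch t; apply: cvg_sumr => i; apply: cvgMl_tmp; apply: cvgB; first exact: cvg_cst.
rewrite expr2; under eq_fun do rewrite expr2.
by apply: cvgM; apply: cvgMl_tmp; exact: ch.
Qed.

(** The cone has no compact base in general: a value [f x] is not controlled by
    [f 0].  Weights with finite total at a given function provide a compact
    convex set that contains this function, and whose extremal points lie on
    extremal rays of the cone. *)
Definition cap : set {ptws G -> R} :=
  [set f | pos_defects e p f /\ forall n, wsum f n <= 1].

Lemma wsum_homo f : (forall x, 0 <= f x) ->
  {homo wsum f : n k / (n <= k)%N >-> n <= k}.
Proof.
move=> f0; apply/nondecreasing_seqP => n.
by rewrite /wsum big_ord_recr lerDl mulr_ge0 // ltW.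
Qed.

(** This bounds each value of a function in [cap], hence compactness. *)
Lemma wsum_coord f i : (forall x, 0 <= f x) ->
  w i * f (e i) <= wsum f i.+1.
Proof.
move=> f0; rewrite /wsum big_ord_recr lerDr.
by apply: sumr_ge0 => k _; rewrite mulr_ge0 // ltW.
Qed.

Lemma wsum_cvg f c : (forall x, 0 <= f x) -> (forall n, wsum f n <= c) ->
  wsum f @ \oo --> limn (wsum f).
Proof.
move=> f0 fc; apply: nondecreasing_is_cvgn; first exact: wsum_homo.
by exists c => _ [n _ <-].
Qed.

Lemma compact_cap : compact cap.
Proof.
have [ix ixE] := choice e_surj.
apply: (@subclosed_compact _ _
    [set f : {ptws G -> R} | forall x, `[0, (w (ix x))^-1]%classic (f x)]).
- rewrite (_ : cap = pos_defects e p `&` \bigcap_(n in [set: nat])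
      [set f : {ptws G -> R} | wsum f n <= 1]); last first.
    by apply/seteqP; split=> f [fpos fw]; split=> // n; [move=> _|]; exact: fw.
  apply: closedI; first exact: closed_pos_defects.
  apply: closed_bigI => n _; apply: closed_fun_le.
  by apply: (@wsum_continuous {ptws G -> R} id) => y; exact: eval_continuous.
- apply: (@tychonoff G (fun _ => R) (fun x => `[0, (w (ix x))^-1]%classic)) => x.
  exact: segment_compact.
move=> f [fpos fw] x /=; have f0 y := pos_defects_ge0 y fpos.
rewrite in_itv /= f0 /= -[x in f x]ixE -[_^-1]mulr1 ler_pdivlMl //.
exact: le_trans (wsum_coord _ f0) (fw _).
Qed.

(** Minimise [g] on [cap], then minimise [saturation] among the minimisers.  For
    the result [f] and [u := p k * f (_ + e k)], let [q] be the ratio of the total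
    weights of [u] and [f].  Then [D := u - q * f] has total weight [0], and both
    [f + D = (1 - q) * f + u] and [f - D = (f - u) + q * f] are in [cap].  Their
    midpoint [f] is doubly minimal, so strict concavity gives [D = 0]. *)
Lemma extremal_minimiser (g : nat -> {ptws G -> R} -> R) (f0 : G -> R) b0 :
  (forall n, continuous (g n)) ->
  (forall f, cap f -> {homo (g^~ f) : n k / (n <= k)%N >-> n <= k}) ->
  (forall n f d, g n (fun x => f x + d x) + g n (fun x => f x - d x) =
    2 * g n f) ->
  cap f0 -> (forall n, g n f0 <= b0) ->
  exists f, [/\ cap f, (forall n, g n f <= b0) &
    forall k, exists q, forall x, p k * f (x + e k) = q * f x].
Proof.
move=> cg mg ag capf0 gf0.
have [m minm [f1 capf1 gf1]] := sup_minimum_exists compact_cap cg mg capf0 gf0.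
have mb0 : m <= b0 by exact: (minm f0).
pose K := cap `&` [set f | forall n, g n f <= m].
have cK : compact K.
  apply: (@subclosed_compact _ _ cap); [|exact: compact_cap|by move=> ? []].
  rewrite (_ : K = cap `&` \bigcap_(n in [set: nat]) [set f | g n f <= m]).
    apply: closedI; last by apply: closed_bigI => n _; exact: closed_fun_le.
    by apply: compact_closed; [exact: hausdorff_product|exact: compact_cap].
  by apply/seteqP; split=> f [capf gf]; split=> // n; [move=> _|]; exact: gf.
pose h n (f : {ptws G -> R}) := saturation f n.
have h2_gt0 i : 0 < 2^-1 ^+ i :> R by rewrite exprn_gt0.
have ch n : continuous (h n).
  by apply: (@saturation_continuous {ptws G -> R} id) => y; exact: eval_continuous.
have cap01 f i : cap f -> 0 <= w i * f (e i) <= 1.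
  move=> [fpos fw]; have f_ge0 y := pos_defects_ge0 y fpos.
  rewrite mulr_ge0 //=; last exact: ltW.
  exact: le_trans (wsum_coord _ f_ge0) (fw _).
have mh f : K f -> {homo (h^~ f) : n k / (n <= k)%N >-> n <= k}.
  move=> [capf _]; apply/nondecreasing_seqP => n.
  rewrite /h /saturation big_ord_recr lerDl mulr_ge0 // subr_ge0.
  by have /andP[? ?] := cap01 f n capf; rewrite exprn_ile1.
have hf1 n : h n f1 <= 2.
  apply: (@le_trans _ _ (\sum_(i < n) 2^-1 ^+ i)).
    by apply: ler_sum => i _; rewrite ler_piMr // gerBl sqr_ge0.
  rewrite (_ : \sum_(i < n) _ = 2 * (1 - 2^-1 ^+ n)).
    by rewrite ler_piMr // gerBl.
  by elim: n => [|n IH]; rewrite ?big_ord0 ?big_ord_recr /= ?IH ?exprS; lra.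
have [m' minm' [f Kf hf]] := sup_minimum_exists cK ch mh (conj capf1 gf1) hf1.
have [capf gf] := Kf; have [fpos fw] := capf.
exists f; split=> // [n|k]; first exact: le_trans (gf n) mb0.
have f_ge0 y := pos_defects_ge0 y fpos.
pose u x := p k * f (x + e k).
have upos : pos_defects e p u.
  have -> : u = (fun x => p k * f (x + e k) + 0 * f x).
    by apply/funext => x; rewrite mul0r addr0.
  by apply: pos_defects_lin => //; exact: pos_defects_shift.
have fupos : pos_defects e p (fun x => f x - u x).
  exact: pos_defects_sub_shift.
have u_ge0 y := pos_defects_ge0 y upos.
have uf y : u y <= f y by rewrite -subr_ge0; exact: (pos_defects_ge0 y fupos).
have uw n : wsum u n <= wsum f n.
  by apply: ler_sum => i _; rewrite ler_pM2l.
have cvf := wsum_cvg f_ge0 fw.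
have cvu : wsum u @ \oo --> limn (wsum u).
  by apply: (@wsum_cvg u 1) => // n; apply: le_trans (uw n) (fw n).
set a := limn (wsum f) in cvf; set b := limn (wsum u) in cvu.
have ge_lim v l n : (forall x, 0 <= v x) -> wsum v @ \oo --> l -> wsum v n <= l.
  move=> v0 vl; rewrite -(cvg_lim _ vl) //; apply: nondecreasing_cvgn_le.
    exact: wsum_homo.
  by apply/cvg_ex; exists l.
have wfa i : w i * f (e i) <= a.
  exact: le_trans (wsum_coord i f_ge0) (ge_lim _ _ _ f_ge0 cvf).
have a1 : a <= 1.
  by rewrite /a; apply: limr_le; [apply/cvg_ex; exists a|exact: nearW].
have b0' : 0 <= b.
  by have := ge_lim u b 0%N u_ge0 cvu; rewrite /wsum big_ord0.
have ba : b <= a.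
  by apply: ler_lim; [apply/cvg_ex; exists b|apply/cvg_ex; exists a|exact: nearW].
(* If [f] has total weight [0], then [f = 0]. *)
have [a0|a_neq0] := eqVneq a 0.
  exists 0 => x; have f00 y : f y = 0.
    have [i <-] := e_surj y; apply/eqP; rewrite eq_le f_ge0 andbT.
    by have := wfa i; rewrite a0 pmulr_rle0.
  by rewrite !f00 !mulr0.
have a_gt0 : 0 < a by rewrite lt_def a_neq0 (le_trans b0').
pose q := b / a.
have q0 : 0 <= q by rewrite divr_ge0 // ltW.
have q1 : q <= 1 by rewrite ler_pdivrMr // mul1r.
pose D x := u x - q * f x.
have wD : wsum D @ \oo --> 0.
  have -> : 0 = b - q * a by rewrite /q divfK // subrr.
  rewrite (_ : wsum D = (fun n => wsum u n - q * wsum f n)).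
    by apply: cvgB => //; exact: cvgMl_tmp.
  apply/funext => n; rewrite /wsum mulr_sumr -sumrB; apply: eq_bigr => i _.
  by rewrite /D; ring.
have inK s : s = 1 \/ s = - 1 -> cap (fun x => f x + s * D x).
  move=> s1; have pos : pos_defects e p (fun x => f x + s * D x).
    case: s1 => ->.
      rewrite (_ : (fun _ => _) = (fun x => (1 - q) * f x + 1 * u x)); last first.
        by apply/funext => x; rewrite /D; ring.
      by apply: pos_defects_lin => //; rewrite subr_ge0.
    rewrite (_ : (fun _ => _) = (fun x => 1 * (f x - u x) + q * f x)); last first.
      by apply/funext => x; rewrite /D; ring.
    exact: pos_defects_lin.
  split=> // n; apply: le_trans a1; apply: ge_lim.
    by move=> x; exact: (pos_defects_ge0 x pos).
  rewrite (_ : wsum _ = (fun n => wsum f n + s * wsum D n)).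
    by rewrite -[a]addr0 -[X in _ + X](mulr0 s); apply: cvgD => //; exact: cvgMl_tmp.
  apply/funext => j; rewrite /wsum mulr_sumr -big_split; apply: eq_bigr => i _ /=.
  by ring.
pose fp x := f x + D x; pose fm x := f x - D x.
have capp : cap fp.
  have := inK 1 (or_introl erefl); rewrite /fp.
  by under eq_fun do rewrite mul1r.
have capm : cap fm.
  have := inK (- 1) (or_intror erefl); rewrite /fm.
  by under eq_fun do rewrite mulN1r.
have gpm n : g n fp + g n fm <= 2 * m - 2 * 0.
  by rewrite ag mulr0 subr0 ler_pM2l.
have [_ gp] := @sup_minimum_midpoint _ _ cap g m fp fm 0 0 minm mg capp capm
  (lexx 0) (fun n _ => gpm n).
have [_ gm] := @sup_minimum_midpoint _ _ cap g m fm fp 0 0 minm mg capm capp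
  (lexx 0) (fun n _ => eq_ind _ (fun t => t <= _) (gpm n) _ (addrC _ _)).
exists q => x; apply/eqP; rewrite -subr_eq0 -/(u x) -/(D x).
have [j <-] := e_surj x.
(* The gain of [saturation] from its [j]-th term alone. *)
pose eta := 2^-1 ^+ j * (w j * D (e j)) ^+ 2.
have eta0 : 0 <= eta by rewrite mulr_ge0 ?sqr_ge0 ?ltW.
have [|etaE _] := @sup_minimum_midpoint _ _ K h m' fp fm eta j.+1 minm' mh
  (conj capp gp) (conj capm gm) eta0.
  move=> n jn.
  have -> : h n fp + h n fm =
      2 * h n f - 2 * \sum_(i < n) 2^-1 ^+ i * (w i * D (e i)) ^+ 2.
    rewrite /h /saturation !mulr_sumr -big_split -sumrB; apply: eq_bigr => i _.
    by rewrite /fp /fm /=; ring.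
  apply: lerB; rewrite ler_pM2l //.
  rewrite (bigD1 (Ordinal jn)) //= lerDl; apply: sumr_ge0 => i _.
  by rewrite mulr_ge0 ?sqr_ge0 ?ltW.
move/eqP: etaE; rewrite mulf_eq0 gt_eqF //= sqrf_eq0 mulf_eq0.
by rewrite gt_eqF.
Qed.

End Extremal.

(** * Extremal functions that stay harmonic *)

Section ExtremalHarmonic.
Variables (R : realType) (G : zmodType) (e : nat -> G) (p : nat -> R).
Hypothesis p_ge0 : forall k, 0 <= p k.
Hypothesis e_surj : forall x, exists i, e i = x.

Lemma sum_half_pow n : \sum_(i < n) 2^-1 ^+ i.+1 <= 1 :> R.
Proof.
rewrite (_ : \sum_(i < n) _ = 1 - 2^-1 ^+ n) ?gerBl //.
by elim: n => [|n IH]; rewrite ?big_ord0 ?big_ord_recr /= ?IH ?exprS; lra.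
Qed.

Lemma defect_sum_continuous (T : topologicalType) (h : T -> G -> R)
    (nu : nat -> nat) n x :
  (forall y, continuous (fun t => h t y)) ->
  continuous (fun t => \sum_(j < n) defect e p (nu j) (h t) x).
Proof.
move=> ch t; apply: cvg_sumr => j.
exact: (@defects_continuous R G e p T h [:: nu j] x ch).
Qed.

Lemma defect_midpoint n (f d : G -> R) x :
  defect e p n (fun x => f x + d x) x + defect e p n (fun x => f x - d x) x =
  2 * defect e p n f x.
Proof.
have := defect_lin e p n 1 1 f d; have := defect_lin e p n 1 (- 1) f d.
move=> /(congr1 (@^~ x)) /= E1 /(congr1 (@^~ x)) /= E2.
move: E1 E2; under eq_fun do rewrite mul1r mulN1r.
under [X in _ -> defect _ _ _ X _ = _ -> _]eq_fun do rewrite !mul1r.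
by move=> -> ->; ring.
Qed.

(** To keep the minimiser harmonic, indices [nu j] are chosen such that
    the defects of [h] at these indices are summable with sum at most half of
    [- F h].  Adding the series of these defects to [F] keeps the value at [h]
    negative; at the minimiser the series is then finite, so its terms, which
    decrease to the limit of the defects, leave no room for a positive limit. *)
Lemma extremal_harmonic (h : G -> R) (F : {ptws G -> R} -> R) :
  null_defect e p h -> continuous F ->
  (forall f d, F (fun x => f x + d x) + F (fun x => f x - d x) = 2 * F f) ->
  F h < 0 ->
  exists f, [/\ pos_defects e p f, F f < 0,
    (forall k, exists q, forall x, p k * f (x + e k) = q * f x) &
    defect e p n f 0 @[n --> \oo] --> 0].
Proof.
move=> hh cF aF Fh; have [h0 hd] := hh.
(* These weights put [h] into [cap]. *)
pose w i : R := 2^-1 ^+ i.+1 / (1 + h (e i)).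
have h1 x : 0 < 1 + h x by rewrite ltr_pwDl.
have w0 i : 0 < w i by rewrite divr_gt0 // exprn_gt0.
have caph : cap e p w h.
  split; first exact: null_defect_pos.
  move=> n; apply: le_trans (sum_half_pow n); apply: ler_sum => i _.
  rewrite /w -mulrA ler_piMr // mulrC ler_pdivrMr // mul1r.
  by rewrite lerDr.
pose eta := - F h / 2; have eta0 : 0 < eta by rewrite /eta; lra.
have /choice[nu nuP] : forall j, exists n,
    defect e p n h 0 <= eta * 2^-1 ^+ j.+1.
  move=> j.
  have ej : 0 < eta * 2^-1 ^+ j.+1 by rewrite mulr_gt0 // exprn_gt0.
  have [n _ Hn] := (cvgr_lt _ (hd 0)) _ ej.
  by exists n; apply/ltW/Hn => /=.
pose g n (f : {ptws G -> R}) := F f + \sum_(j < n) defect e p (nu j) f 0.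
have [|||||f [[fpos _] gf fq]] :=
  @extremal_minimiser R G e p w p_ge0 e_surj w0 g h (F h / 2).
- move=> n; apply: (@continuous_addr R {ptws G -> R} F _ cF).
  apply: (@defect_sum_continuous {ptws G -> R} id) => y; exact: eval_continuous.
- move=> f [fpos _]; apply/nondecreasing_seqP => n.
  by rewrite /g big_ord_recr /= addrA lerDl pos_defects_defect_ge0.
- move=> n f d; rewrite /g addrACA aF -big_split mulrDr mulr_sumr; congr (_ + _).
  by apply: eq_bigr => j _; exact: defect_midpoint.
- exact: caph.
- move=> n; rewrite /g; have : \sum_(j < n) defect e p (nu j) h 0 <= eta.
    apply: (@le_trans _ _ (\sum_(j < n) eta * 2^-1 ^+ j.+1)).
      by apply: ler_sum => j _; exact: nuP.
    by rewrite -mulr_sumr ler_piMr ?sum_half_pow // ltW.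
  rewrite /eta; lra.
have f0 x := pos_defects_ge0 x fpos.
have fd0 n := pos_defects_defect_ge0 n 0 fpos.
exists f; split=> //.
  by have := gf 0%N; rewrite /g big_ord0; lra.
have mono := @defect_homo R G e p p_ge0 f 0 f0.
have cvd : cvgn (fun n => defect e p n f 0).
  by apply: nonincreasing_is_cvgn mono _; exists 0 => _ [n _ <-].
suff E : limn (fun n => defect e p n f 0) = 0 by rewrite -E.
set l := limn _; have l_le n : l <= defect e p n f 0.
  exact: nonincreasing_cvgn_ge.
have l0 : 0 <= l by apply: limr_ge => //; exact: nearW.
apply/eqP/negPn/negP => l_neq0; have l_gt0 : 0 < l by rewrite lt_def l_neq0.
(* [C] bounds the penalty at [f], all of whose terms are at least [l]. *)
pose C := F h / 2 - F f.
have bound n : n%:R * l <= C.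
  rewrite /C lerBrDl; apply: le_trans (gf n); rewrite lerD2l.
  rewrite -[X in X%:R]card_ord -sumr_const mulr_suml; apply: ler_sum => j _.
  by rewrite mul1r.
have C0 : 0 <= C by have := bound 0%N; rewrite mul0r.
have := bound (Num.bound (C / l)); apply/negP; rewrite -ltNge.
rewrite -ltr_pdivrMr //; apply: archi_boundP.
by rewrite divr_ge0.
Qed.

End ExtremalHarmonic.

(** * Linear algebra over the lattice *)

Lemma common_denominator r (c : 'rV[rat]_r) :
  exists2 N, (0 < N)%N & exists n : 'I_r -> int,
    forall j, N%:R * c 0 j = (n j)%:~R.
Proof.
pose N := \prod_j denq (c 0 j).
have N0 : 0 < N by apply: prodr_gt0 => j _; exact: denq_gt0.
exists `|N|%N; first by rewrite absz_gt0 gt_eqF.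
exists (fun j => (\prod_(i | i != j) denq (c 0 i)) * numq (c 0 j)) => j.
rewrite pmulrn gtz0_abs // /N (bigD1 j) //= !intrM numqE.
ring.
Qed.

Lemma mulrz_entry d (x : Zlattice d) (z : int) i :
  (x *~ z) ord0 i = x ord0 i * z.
Proof.
case: z => n; first by rewrite [LHS]mulmxnE -mulr_natr natz.
by rewrite [LHS]mxE [X in - X]mulmxnE NegzE mulrN -mulr_natr natz.
Qed.

(** [B] is a maximal linearly independent family in [S], so that each element
    of [S] is a rational combination of it; [D] is a right inverse of the matrix
    with rows [B j], used to prescribe the values of [dotp (B j)] at will. *)
Lemma lattice_basis (R : realType) d (S : set (Zlattice d)) :
  exists r (B : 'I_r -> Zlattice d) (D : 'M[R]_(r, d)),
  [/\ forall j, S (B j),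
      forall k, S k -> exists2 N, (0 < N)%N & exists n : 'I_r -> int,
        k *+ N = \sum_j B j *~ n j
    & forall v j, dotp (B j) (v *m D) = v 0 j].
Proof.
pose toM r (B : 'I_r -> Zlattice d) : 'M[rat]_(r, d) :=
  \matrix_(j, i) (B j ord0 i)%:~R.
pose P r := `[< exists2 B : 'I_r -> Zlattice d,
  forall j, S (B j) & row_free (toM r B) >].
have P0 : exists r, P r.
  exists 0%N; apply/asboolP; exists (fun _ => 0); first by case.
  by rewrite /row_free; apply/eqP; apply/eqP; rewrite -leqn0 rank_leq_row.
have Pd r : P r -> (r <= d)%N.
  by move=> /asboolP[B _ /eqP <-]; exact: rank_leq_col.
case: (ex_maxnP P0 Pd) => r /asboolP[B BS freeB] maxr.
have [B' B'E] := row_freeP freeB.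
exists r, B, (map_mx ratr B'^T); split=> //; last first.
  move=> v j.
  have dual l : \sum_i (B j ord0 i)%:~R * ratr (B' i l) = (j == l)%:R :> R.
    have := congr1 (fun A : 'M[rat]_(r, r) => ratr (A j l) : R) B'E.
    rewrite !mxE ratr_nat rmorph_sum /= => <-.
    by apply: eq_bigr => i _; rewrite rmorphM /= mxE ratr_int.
  rewrite /dotp; under eq_bigr => i _ do rewrite mxE mulr_sumr.
  rewrite exchange_big /= (eq_bigr (fun l => v 0 l * (j == l)%:R)).
    rewrite (bigD1 j) //= eqxx mulr1 big1 ?addr0 // => l lj.
    by rewrite eq_sym (negbTE lj) mulr0.
  move=> l _; rewrite -dual mulr_sumr; apply: eq_bigr => i _.
  by rewrite !mxE mulrCA.
move=> k Sk; pose kq : 'rV[rat]_d := \row_i (k ord0 i)%:~R.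
have [/submxP[c kc]|kM] := boolP (kq <= toM r B)%MS.
  have [N N0 [n nE]] := common_denominator c.
  exists N => //; exists n; apply/rowP => i; apply: (@intr_inj rat).
  have := congr1 (fun A : 'M[rat]_(1, d) => A 0 i) kc; rewrite !mxE => E.
  rewrite mulmxnE summxE !rmorph_sum /= rmorphMn /= E -mulr_natl mulr_sumr.
  apply: eq_bigr => j _; rewrite mxE mulrA nE.
  by rewrite -intrM mulrz_entry mulrC.
(* Otherwise [k] could be added to the family [B]. *)
suff /maxr : P (r + 1)%N by rewrite addn1 ltnn.
apply/asboolP.
exists (fun j : 'I_(r + 1) => if fintype.split j is inl j' then B j' else k).
  by move=> j; case: fintype.split.
rewrite (_ : toM _ _ = col_mx (toM r B) kq).
  rewrite /row_free -addsmxE eqn_leq (leq_trans (mxrank_adds_leqif _ _)) /=.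
    rewrite addn1 -[X in (X < _)%N](eqP freeB); apply: rank_ltmx.
    rewrite ltmxE addsmxSl /=.
    by apply: contra kM; apply: submx_trans; exact: addsmxSr.
  by rewrite leq_add ?rank_leq_row.
by apply/matrixP => j i; rewrite !mxE; case: fintype.split => l; rewrite mxE.
Qed.

(** * Exponentials on the lattice and their Laplace transform *)

Section Dotp.
Variables (R : realType) (d : nat).
Implicit Types (x y : Zlattice d) (s : 'rV[R]_d).

Lemma dotpD x y s : dotp (x + y) s = dotp x s + dotp y s.
Proof.
rewrite /dotp -big_split; apply: eq_bigr => i _ /=.
by rewrite mxE intrD mulrDl.
Qed.

Lemma dotpN x s : dotp (- x) s = - dotp x s.
Proof.
by rewrite /dotp -sumrN; apply: eq_bigr => i _ /=; rewrite mxE intrN mulNr.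
Qed.

Lemma dotp0 s : dotp (0 : Zlattice d) s = 0.
Proof. by rewrite -(subrr (0 : Zlattice d)) dotpD dotpN subrr. Qed.

Lemma dotpMn x N s : dotp (x *+ N) s = N%:R * dotp x s.
Proof.
elim: N => [|N IH]; first by rewrite mulr0n dotp0 mul0r.
by rewrite mulrS dotpD IH -natr1 mulrDl mul1r addrC.
Qed.

Lemma dotpMz x (z : int) s : dotp (x *~ z) s = z%:~R * dotp x s.
Proof.
case: z => n; first exact: dotpMn.
by rewrite NegzE mulrNz dotpN [in LHS]dotpMn intrN mulNr.
Qed.

Lemma dotp_sum (I : Type) (r : seq I) (x : I -> Zlattice d) s :
  dotp (\sum_(i <- r) x i) s = \sum_(i <- r) dotp (x i) s.
Proof.
elim: r => [|i r IH]; first by rewrite !big_nil dotp0.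
by rewrite !big_cons dotpD IH.
Qed.

Lemma dotp_continuous x : continuous (dotp x : 'rV[R]_d -> R).
Proof.
apply: continuous_sumr_scale => i; exact: coord_continuous.
Qed.

End Dotp.

Section Lattice.
Variables (R : realType) (d : nat) (e : nat -> Zlattice d) (p : nat -> R).
Hypothesis p_ge0 : forall k, 0 <= p k.
Hypothesis e_surj : forall x, exists k, e k = x.
Implicit Types (s : 'rV[R]_d) (f h : Zlattice d -> R).

Definition laplace n s : R := \sum_(k < n) p k * expR (dotp (e k) s).

(** The set [E1] of the measure with weights [p k] at [e k]. *)
Definition unit_laplace : set 'rV[R]_d :=
  [set s | laplace n s @[n --> \oo] --> (1 : R)].

Lemma laplace_homo s : {homo laplace^~ s : n k / (n <= k)%N >-> n <= k}.
Proof.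
apply/nondecreasing_seqP => n.
by rewrite /laplace big_ord_recr lerDl mulr_ge0 // expR_ge0.
Qed.

Lemma laplace_continuous n : continuous (laplace n).
Proof.
apply: continuous_sumr_scale => k s.
by apply: continuous_comp; [exact: dotp_continuous|exact: continuous_expR].
Qed.

Lemma defect_exp n s x :
  defect e p n (fun y => expR (dotp y s)) x = (1 - laplace n s) * expR (dotp x s).
Proof.
rewrite /defect mulrBl mul1r mulr_suml; congr (_ - _).
by apply: eq_bigr => k _; rewrite dotpD expRD; ring.
Qed.

Lemma null_defect_exp s :
  unit_laplace s <-> null_defect e p (fun y => expR (dotp y s)).
Proof.
split=> [sE|[_ /(_ 0)]].
  split=> x; first exact: expR_ge0.
  under eq_fun do rewrite defect_exp.
  rewrite -(mul0r (expR (dotp x s))) -[X in X * _](subrr 1).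
  by apply: cvgMr_tmp; apply: cvgB => //; exact: cvg_cst.
under eq_fun do rewrite defect_exp dotp0 expR0 mulr1.
move=> cv0; rewrite /unit_laplace /=.
rewrite (_ : (fun _ => _) = (fun n => 1 - (1 - laplace n s))); last first.
  by apply/funext => n; rewrite subKr.
have c1 : (1 : R) @[_ --> \oo] --> (1 : R) by exact: cvg_cst.
have /(_ _) := cvgB c1 cv0; rewrite subr0; exact.
Qed.

Variables (r : nat) (B : 'I_r -> Zlattice d) (D : 'M[R]_(r, d)).
Let S : set (Zlattice d) := [set x | exists2 k, 0 < p k & e k = x].
Hypothesis BS : forall j, S (B j).
Hypothesis B_span : forall k, S k -> exists2 N, (0 < N)%N &
  exists n : 'I_r -> int, k *+ N = \sum_j B j *~ n j.
Hypothesis B_dual : forall v j, dotp (B j) (v *m D) = v 0 j.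

(** At an exponential [f] this is at least [1], and large as soon as some
    [dotp (B j) s] is large in absolute value.  The points [- B j] are needed for
    the latter although they may lie outside the support. *)
Definition two_sided_sum f : R := f 0 + \sum_j (f (B j) + f (- B j)).

Lemma dotp_determined s t x : S x ->
  (forall j, dotp (B j) s = dotp (B j) t) -> dotp x s = dotp x t.
Proof.
move=> /B_span[N N0 [n xE]] st.
have N0' : (N%:R : R) != 0 by rewrite pnatr_eq0 -lt0n.
apply: (mulfI N0'); rewrite -!dotpMn xE !dotp_sum.
by apply: eq_bigr => j _; rewrite !dotpMz st.
Qed.

Lemma laplace_determined s t n :
  (forall j, dotp (B j) s = dotp (B j) t) -> laplace n s = laplace n t.
Proof.
move=> st; apply: eq_bigr => k _.
have [pk|pk] := ltP 0 (p k); first by rewrite (dotp_determined _ st) //; exists k.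
by rewrite (_ : p k = 0) ?mul0r //; apply/eqP; rewrite eq_le pk p_ge0.
Qed.

(** Otherwise for each [n] some [s] in [unit_laplace] violates the bound.  The
    coordinates [v j = dotp (B j) s] are then at most [eps^-1] in absolute value,
    and [s] may be replaced by [v *m D], which gives the same partial transforms
    since these depend only on the [dotp (B j) s].  The resulting nonempty sets
    [C n] decrease; a common point, provided by compactness, would lie in the
    closed set [unit_laplace] but have partial transforms at most [1 - eps]. *)
Lemma uniform_laplace eps : closed unit_laplace -> 0 < eps ->
  exists n, forall s, unit_laplace s ->
    1 - laplace n s <= eps * two_sided_sum (fun x => expR (dotp x s)).
Proof.
move=> clE eps0; apply: contrapT => /forallNP noN.
have bad n : exists2 s, unit_laplace s &
    eps * two_sided_sum (fun x => expR (dotp x s)) < 1 - laplace n s.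
  move: (noN n) => /existsNP[s /not_implyP[sE /negP]].
  by rewrite -ltNge => ?; exists s.
pose K := [set v : 'rV[R]_r | forall j, `[- eps^-1, eps^-1]%classic (v 0 j)].
have cK : compact K.
  apply: (@rV_compact R r (fun _ => `[- eps^-1, eps^-1]%classic)) => j.
  exact: segment_compact.
have cD : continuous (fun v : 'rV[R]_r => v *m D : 'rV[R]_d).
  apply: continuous_mx_entry => i j.
  rewrite (_ : (fun _ => _) = (fun v : 'rV[R]_r => \sum_l D l j * v i l)).
    by apply: continuous_sumr_scale => l; exact: coord_continuous.
  by apply/funext => v; rewrite mxE; apply: eq_bigr => l _; rewrite mulrC.
pose C n := [set v : 'rV[R]_r |
  unit_laplace (v *m D) /\ laplace n (v *m D) <= 1 - eps].
have lap_le1 n s : unit_laplace s -> laplace n s <= 1.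
  move=> sE; rewrite -(cvg_lim _ sE) //; apply: nondecreasing_cvgn_le.
    exact: laplace_homo.
  by apply/cvg_ex; exists 1.
have [||||v Kv Cv] := @compact_directed_inter _ nat K setT C cK.
- by exists 0%N.
- move=> n _; rewrite (_ : C n = (fun v => v *m D) @^-1`
      (unit_laplace `&` [set s | laplace n s <= 1 - eps])); last by [].
  apply: preimage_closed => //; apply: closedI => //; apply: closed_fun_le.
  exact: laplace_continuous.
- move=> i j _ _; exists (maxn i j) => // v [_ [vE vm]]; split; split=> //;
    apply: le_trans vm; apply: laplace_homo.
    exact: leq_maxl.
  exact: leq_maxr.
- move=> n _; have [s sE sbad] := bad n.
  pose v := \row_j dotp (B j) s; have vs j : dotp (B j) (v *m D) = dotp (B j) s.
    by rewrite B_dual mxE.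
  have lapv k : laplace k (v *m D) = laplace k s by exact: laplace_determined.
  set W := two_sided_sum _ in sbad.
  have W1 : eps * W < 1.
    apply: (lt_le_trans sbad); rewrite gerBl.
    by apply: sumr_ge0 => k _; rewrite mulr_ge0 // expR_ge0.
  have sum_ge0 : 0 <= \sum_j (expR (dotp (B j) s) + expR (dotp (- B j) s)).
    by apply: sumr_ge0 => j _; rewrite addr_ge0 // expR_ge0.
  have W_ge j : expR (dotp (B j) s) <= W /\ expR (- dotp (B j) s) <= W.
    have := expR_ge0 (dotp (B j) s); have := expR_ge0 (- dotp (B j) s).
    have := expR_ge0 (dotp 0 s).
    rewrite /W /two_sided_sum (bigD1 j) //= dotpN.
    have : 0 <= \sum_(i | i != j) (expR (dotp (B i) s) + expR (dotp (- B i) s)).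
      by apply: sumr_ge0 => i _; rewrite addr_ge0 // expR_ge0.
    lra.
  have Weps : W <= eps^-1 by rewrite -[_^-1]mulr1 ler_pdivlMl // ltW.
  exists v; split=> [j|].
    rewrite /= in_itv /= mxE; have [W1' W2] := W_ge j.
    have := expR_ge1Dx (dotp (B j) s); have := expR_ge1Dx (- dotp (B j) s).
    by move=> ? ?; apply/andP; split; lra.
  split.
    rewrite /unit_laplace /=; under eq_fun do rewrite lapv.
    exact: sE.
  rewrite lapv lerBrDl -lerBrDr; apply: le_trans (ltW sbad).
  by rewrite ler_peMr ?(ltW eps0) // /W /two_sided_sum dotp0 expR0 lerDl sum_ge0.
have vE := (Cv 0%N I).1.
have : laplace n (v *m D) @[n --> \oo] --> (1 : R) by exact: vE.
move=> /cvgr_gt /(_ (1 - eps)); rewrite gtrBl => /(_ eps0) [n _ Hn].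
have := (Cv n I).2; have /= := Hn n (leqnn n); lra.
Qed.

Lemma two_sided_sum_midpoint f g :
  two_sided_sum (fun x => f x + g x) + two_sided_sum (fun x => f x - g x) =
  2 * two_sided_sum f.
Proof.
rewrite /two_sided_sum addrACA -big_split mulrDr mulr_sumr; congr (_ + _); first ring.
by apply: eq_bigr => j _ /=; ring.
Qed.

Lemma two_sided_sum_continuous (T : topologicalType) (h : T -> Zlattice d -> R) :
  (forall y, continuous (fun t => h t y)) ->
  continuous (fun t => two_sided_sum (h t)).
Proof.
move=> ch t; apply: cvgD; first exact: ch.
by apply: cvg_sumr => j; apply: cvgD; exact: ch.
Qed.

(** The vectors along which [f] is multiplied by an exponential form a group
    [M].  Choosing [s] with the right values on the [B j], this group contains
    the [B j] and therefore a positive multiple [x *+ N] of any [x] in [S]; the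
    factor of [f] along [x] is positive and its [N]-th power is that of an
    exponential, so it is that of an exponential as well. *)
Lemma multiplicative_exp f : (forall x, 0 <= f x) -> 0 < f 0 ->
  (forall k, exists q, forall x, p k * f (x + e k) = q * f x) ->
  exists s, (forall x, S x -> f x = expR (dotp x s) * f 0) /\
    (forall j, f (- B j) = expR (- dotp (B j) s) * f 0).
Proof.
move=> f_ge0 f0 fq.
have ratio x : S x -> exists2 c, 0 < c & forall y, f (y + x) = c * f y.
  move=> [k pk <-]; have [q qE] := fq k.
  have fE y : f (y + e k) = q / p k * f y.
    by rewrite mulrAC -qE mulrC mulKf // gt_eqF.
  exists (q / p k) => //; rewrite lt_def; apply/andP; split; last first.
    by have := f_ge0 (0 + e k); rewrite fE pmulr_lge0.
  apply/eqP => q0; have := fE (- e k).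
  by rewrite addNr q0 mul0r => /eqP; rewrite gt_eqF.
have /choice[c cP] : forall j, exists c, 0 < c /\
    forall y, f (y + B j) = c * f y.
  by move=> j; have [c c0 cE] := ratio _ (BS j); exists c.
pose s : 'rV[R]_d := (\row_j ln (c j)) *m D.
have expB j : expR (dotp (B j) s) = c j.
  by rewrite /s B_dual mxE lnK // posrE; have [] := cP j.
pose M := [set x : Zlattice d | forall y, f (y + x) = expR (dotp x s) * f y].
have MD x y : M x -> M y -> M (x + y).
  by move=> Mx My z; rewrite addrA My Mx dotpD expRD; ring.
have MN x : M x -> M (- x).
  move=> Mx z; rewrite -[in RHS](subrK x z) Mx dotpN expRN mulKf //.
  by rewrite gt_eqF // expR_gt0.
have M0 : M 0 by move=> y; rewrite addr0 dotp0 expR0 mul1r.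
have MB j : M (B j) by move=> y; rewrite expB; have [_ ->] := cP j.
have MZ x (z : int) : M x -> M (x *~ z).
  move=> Mx; have Mn n : M (x *+ n).
    by elim: n => [|n IH]; rewrite ?mulr0n ?mulrS //; exact: MD.
  by case: z => n; [exact: Mn|rewrite NegzE mulrNz; apply: MN; exact: Mn].
exists s; split=> [x Sx|j]; last first.
  by rewrite -[- B j]add0r MN // dotpN.
have [N N0 [n xE]] := B_span Sx; have [a a0 aE] := ratio x Sx.
have MNx : M (x *+ N).
  rewrite xE; elim: (index_enum _) => [|j l IH]; first by rewrite big_nil.
  by rewrite big_cons; apply: MD => //; exact: MZ.
have fn k : f (x *+ k) = a ^+ k * f 0.
  elim: k => [|k IH]; first by rewrite mulr0n expr0 mul1r.
  by rewrite mulrS addrC aE IH exprS mulrA.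
have : a ^+ N = expR (dotp x s) ^+ N.
  apply: (mulIf (lt0r_neq0 f0)); rewrite -fn -[x *+ N]add0r MNx dotpMn.
  by rewrite -expRM_natl.
move=> /(pexpIrn N0) aX; rewrite -[x in LHS]add0r aE aX //.
  by rewrite nnegrE ltW.
by rewrite nnegrE expR_ge0.
Qed.

(** Inequalities between the values at finitely many points that hold for
    harmonic exponentials are inherited by all nonnegative harmonic functions;
    this is the instance that is needed. *)
Lemma defect_le_two_sided h eps n : null_defect e p h -> 0 <= eps ->
  (forall s, unit_laplace s ->
    1 - laplace n s <= eps * two_sided_sum (fun x => expR (dotp x s))) ->
  defect e p n h 0 <= eps * two_sided_sum h.
Proof.
move=> hh eps0 bound; rewrite leNgt; apply/negP => lt_h.
pose F (f : {ptws Zlattice d -> R}) := eps * two_sided_sum f - defect e p n f 0.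
have cF : continuous F.
  suff gen (T : topologicalType) (g : T -> Zlattice d -> R) :
      (forall y, continuous (fun t => g t y)) ->
      continuous (fun t => eps * two_sided_sum (g t) - defect e p n (g t) 0).
    by apply: (gen {ptws Zlattice d -> R} id) => y; exact: eval_continuous.
  move=> cg t; apply: cvgB.
    by apply: cvgMl_tmp; exact: two_sided_sum_continuous.
  exact: (@defects_continuous R _ e p T g [:: n] 0 cg).
have aF f g : F (fun x => f x + g x) + F (fun x => f x - g x) = 2 * F f.
  rewrite /F addrACA -mulrDr two_sided_sum_midpoint -opprD defect_midpoint; ring.
have Fh : F h < 0 by rewrite /F subr_lt0.
have [f [fpos Ff fq fd]] := extremal_harmonic p_ge0 e_surj hh cF aF Fh.
have f_ge0 x := pos_defects_ge0 x fpos.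
have two_sided_ge : f 0 <= two_sided_sum f.
  by rewrite lerDl; apply: sumr_ge0 => j _; rewrite addr_ge0.
have f0 : 0 < f 0.
  rewrite lt_def f_ge0 andbT; apply/eqP => f0.
  have : defect e p n f 0 <= f 0.
    by rewrite gerBl; apply: sumr_ge0 => k _; rewrite mulr_ge0.
  have : 0 <= eps * two_sided_sum f by rewrite mulr_ge0 // -f0.
  by move: Ff; rewrite /F; lra.
(* From here on [f] may be replaced by [f 0] times an exponential, whose exponent
   is in [unit_laplace] because [f] is harmonic at [0]. *)
have [s [fS fB]] := multiplicative_exp f_ge0 f0 fq.
have dE k : defect e p k f 0 = (1 - laplace k s) * f 0.
  rewrite /defect mulrBl mul1r mulr_suml; congr (_ - _).
  apply: eq_bigr => j _; have [pj|pj] := ltP 0 (p j).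
    by rewrite add0r fS ?mulrA //; exists j.
  by rewrite (_ : p j = 0) ?mul0r //; apply/eqP; rewrite eq_le pj p_ge0.
have sE : unit_laplace s.
  apply/null_defect_exp; split=> x; first exact: expR_ge0.
  under eq_fun do rewrite defect_exp.
  rewrite (_ : (fun _ => _) =
    (fun k => defect e p k f 0 * (expR (dotp x s) / f 0))).
    by rewrite -(mul0r (expR (dotp x s) / f 0)); apply: cvgMr_tmp.
  apply/funext => k; rewrite dE -mulrA; congr (_ * _).
  by rewrite mulrCA divff ?mulr1 // gt_eqF.
have WE : two_sided_sum f = two_sided_sum (fun x => expR (dotp x s)) * f 0.
  rewrite /two_sided_sum dotp0 expR0 mulrDl mul1r mulr_suml; congr (_ + _).
  by apply: eq_bigr => j _; rewrite fB fS // dotpN mulrDl.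
have := bound s sE; rewrite -(ler_pM2r f0) -dE -mulrA -WE.
by move: Ff; rewrite /F; lra.
Qed.

(** The index [n] given by [uniform_laplace] does not depend on [m], so the bound
    of [defect_le_two_sided] for the translates of [fs m] passes to the limit. *)
Lemma null_defect_limit (fs : nat -> Zlattice d -> R) f :
  closed unit_laplace -> (forall m, null_defect e p (fs m)) ->
  (forall x, 0 <= f x) -> (forall x, fs m x @[m --> \oo] --> f x) ->
  null_defect e p f.
Proof.
move=> clE hfs f_ge0 fsf; split=> // x.
pose fx y := f (y + x); pose fsx m y := fs m (y + x).
have fsxh m : null_defect e p (fsx m) by exact: null_defect_shift.
have cvd n : defect e p n (fsx m) 0 @[m --> \oo] --> defect e p n f x.
  apply: cvgB; first by rewrite /fsx add0r; exact: fsf.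
  by apply: cvg_sumr => k; apply: cvgMl_tmp; rewrite /fsx add0r addrC; exact: fsf.
have cvs : two_sided_sum (fsx m) @[m --> \oo] --> two_sided_sum fx.
  apply: cvgD; first exact: fsf.
  by apply: cvg_sumr => j; apply: cvgD; exact: fsf.
have d_ge0 n : 0 <= defect e p n f x.
  apply: (ler_cvg_to (@cvg_cst _ _ _ _ _) (cvd n)); apply: nearW => m.
  by apply: pos_defects_defect_ge0; exact: null_defect_pos.
have s_ge0 : 0 <= two_sided_sum fx.
  rewrite addr_ge0 ?f_ge0 // sumr_ge0 // => j _.
  by rewrite addr_ge0 ?f_ge0.
apply/cvgr0Pnorm_lt => eps eps0.
pose eps' := eps / (1 + two_sided_sum fx).
have s1 : 0 < 1 + two_sided_sum fx by rewrite ltr_pwDl.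
have eps'0 : 0 < eps' by rewrite divr_gt0.
have [n nP] := uniform_laplace clE eps'0.
have dn : defect e p n f x <= eps' * two_sided_sum fx.
  have cvs' :
      eps' * two_sided_sum (fsx m) @[m --> \oo] --> eps' * two_sided_sum fx.
    exact: cvgMl_tmp.
  apply: (ler_cvg_to (cvd n) cvs'); apply: nearW => m.
  by apply: defect_le_two_sided => //; exact: ltW.
exists n => // k /= nk; rewrite ger0_norm //.
apply: le_lt_trans (_ : eps' * two_sided_sum fx < _); last first.
  by rewrite /eps' mulrAC ltr_pdivrMr // ltr_pM2l // ltrDr.
by apply: le_trans dn; exact: defect_homo.
Qed.

End Lattice.

(** * From the integral to a series *)

Section Measure.
Variables (R : realType) (d : nat) (mu : probability (Zlattice d) R).

(** Codes of no lattice point are sent to [0]; they get mass [0] below, so the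
    repetitions do no harm. *)
Definition lattice_enum (k : nat) : Zlattice d := odflt 0 (unpickle k).

Definition mass (k : nat) : R := fine (mu [set x : Zlattice d | pickle x = k]).

Lemma mass_ge0 k : 0 <= mass k.
Proof. by rewrite fine_ge0. Qed.

Lemma lattice_enum_surj x : exists k, lattice_enum k = x.
Proof. by exists (pickle x); rewrite /lattice_enum pickleK. Qed.

(** The integrand is constant on the countably many sets of points with a given
    code, each of which is empty or a singleton. *)
Lemma integral_lattice (g : Zlattice d -> R) : (forall x, 0 <= g x) ->
  (\int[mu]_x (g x)%:E = \sum_(0 <= k <oo) (mass k * g (lattice_enum k))%:E)%E.
Proof.
move=> g0; pose F k := [set x : Zlattice d | pickle x = k].
have mF (A : set (Zlattice d)) : measurable A by [].
have FT : \bigcup_k F k = setT.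
  by apply/seteqP; split=> // x _; exists (pickle x).
have tF : trivIset setT F by move=> i j _ _ [x [<- <-]].
rewrite -FT (ge0_integral_bigcup mu _ _ _ tF) => [|k|_ A _|x _];
  [|exact: mF|exact: mF|by rewrite lee_fin].
apply: eq_eseriesr => k _.
rewrite (eq_integral (cst (g (lattice_enum k))%:E)).
  rewrite integral_cst // EFinM muleC /mass fineK //.
  exact: fin_num_measure.
by move=> x; rewrite inE /F /= => <-; rewrite /lattice_enum pickleK.
Qed.

Lemma nonneg_harmonicE f :
  nonneg_harmonic mu f <-> null_defect lattice_enum mass f.
Proof.
have step x : (forall y, 0 <= f y) ->
    ((f x)%:E = \int[mu]_y (f (x + y))%:E)%E <->
    (defect lattice_enum mass n f x @[n --> \oo] --> 0).
  move=> f0; rewrite (integral_lattice (fun y => f0 (x + y))).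
  have sumE := @nneseries_EFin R
    (fun k => mass k * f (x + lattice_enum k)) (f x)
    (fun k => mulr_ge0 (mass_ge0 k) (f0 _)).
  split=> [/esym /sumE cv|cv].
    rewrite -(subrr (f x)); apply: cvgB => //; exact: cvg_cst.
  apply/esym/sumE.
  rewrite (_ : (fun _ => _) =
    (fun n => f x - defect lattice_enum mass n f x)); last first.
    by apply/funext => n; rewrite subKr.
  have c1 : f x @[_ --> \oo] --> f x by exact: cvg_cst.
  have /(_ _) := cvgB c1 cv; rewrite subr0; exact.
by split=> -[f0 hf]; split=> // x; apply/(step x f0); exact: hf.
Qed.

Lemma E1E : E1 mu = unit_laplace lattice_enum mass.
Proof.
have E s := @nneseries_EFin R
  (fun k => mass k * expR (dotp (lattice_enum k) s)) 1
  (fun k => mulr_ge0 (mass_ge0 k) (expR_ge0 _)).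
by apply/seteqP; split=> s; rewrite /E1 /unit_laplace /laplace /=
  (integral_lattice (fun x => expR_ge0 (dotp x s))) => /E.
Qed.

End Measure.

Theorem theorem1 (R : realType) (d : nat) (hd : (1 <= d)%N)
    (mu : probability (Zlattice d) R) :
  stable_pointwise_limits mu <-> closed (E1 mu).
Proof.
rewrite E1E; pose e := @lattice_enum d; pose p := mass mu.
have p0 : forall k, 0 <= p k by exact: mass_ge0.
split=> [stable s cls|clE fs f hfs f0 fsf].
  apply/null_defect_exp/nonneg_harmonicE.
  have /choice[t tP] : forall n : nat, exists t : 'rV[R]_d,
      unit_laplace e p t /\ ball s n.+1%:R^-1 t.
    move=> n; have [|t [tE st]] := cls (ball s n.+1%:R^-1); last by exists t.
    by apply: nbhsx_ballx; rewrite invr_gt0.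
  have ts : t n @[n --> \oo] --> s.
    apply/cvg_ballP => eps eps0.
    have [N _ HN] := near_infty_natSinv_lt (PosNum eps0).
    exists N => // n /HN /= nE; apply: le_ball (ltW nE) _ _.
    by have [] := tP n.
  apply: (stable (fun n x => expR (dotp x (t n)))).
  - by move=> n; apply/nonneg_harmonicE/null_defect_exp; have [] := tP n.
  - by move=> x; exact: expR_ge0.
  - move=> x; apply: (cvg_comp (fun n => dotp x (t n)) expR).
      apply: (cvg_comp t (dotp x) ts); exact: dotp_continuous.
    exact: continuous_expR.
have [r [B [D [BS B_span B_dual]]]] :=
  lattice_basis R [set x | exists2 k, 0 < p k & e k = x].
apply/nonneg_harmonicE.
apply: (null_defect_limit p0 (@lattice_enum_surj d) BS B_span B_dual clE _ f0 fsf).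
by move=> m; apply/nonneg_harmonicE; exact: hfs.
Qed.
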